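(* Let $p:E\to B$ be any fibration of topological spaces (a continuous map satisfying the homotopy lifting property). Then there exists a representation up to homotopy of $Sing(B)$ on $E$. That is, there exists a collection $\{\theta_k\}_{k\ge 0}$ which assigns to every $k\ge 0$ and every singular $k$-simplex $\sigma:\Delta^k\to B$ a continuous map $\theta_k(\sigma)$, where $\theta_0(\sigma):F_0\to F_0$ and, for $k\geq 1$, $\theta_k(\sigma): I^{k-1}\times F_0\to F_k$ (with $F_i=F_i(\sigma)=p^{-1}(\sigma(i))$ the fibre over the $i$-th vertex of $\sigma$), such that: (1) for every $0$-simplex $\sigma$, $\theta_0(\sigma)$ is the identity on $F_0$; (2) for every $k\ge 1$, every singular $k$-simplex $\sigma$ and every $(t_1,\dots,t_{k-1})\in I^{k-1}$, the map $\theta_k(\sigma)(t_1,\dots,t_{k-1},-):F_0\to F_k$ is a homotopy equivalence; (3) for every $k\geq 2$, every singular $k$-simplex $\sigma$, every $1\le p\le k-1$, every $e\in F_0$ and all values in $I$ of the remaining coordinates, $$\theta_k(\sigma)(t_1,\dots,t_{p-1},0,t_{p+1},\dots,t_{k-1},e)=\theta_{k-1}(\partial_p\sigma)(t_1,\dots,t_{p-1},t_{p+1},\dots,t_{k-1},e);$$ (4) for every $k\geq 2$, every singular $k$-simplex $\sigma$, every $1\le p\le k-1$, with $q=k-p$, every $e\in F_0$ and all values in $I$ of the remaining coordinates, $$\theta_k(\sigma)(t_1,\dots,t_{p-1},1,t_{p+1},\dots,t_{k-1},e)=\theta_{q}(\sigma|_{\langle p,\dots,k\rangle})\bigl(t_{p+1},\dots,t_{k-1},\,\theta_p(\sigma|_{\langle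 0,\dots,p\rangle})(t_1,\dots,t_{p-1},e)\bigr).$$
   Context: $I=[0,1]$, and $I^0$ is a point. A fibration is a continuous map $p:E\to B$ of topological spaces satisfying the homotopy lifting property (with respect to all spaces, i.e. a Hurewicz fibration; equivalently, one admitting a path lifting function). $Sing(B)$ is the singular simplicial set of $B$: its $k$-simplices are all continuous maps $\sigma:\Delta^k\to B$, where $\Delta^k$ is the standard $k$-simplex with ordered vertices $0,1,\dots,k$. A simplex $\sigma$ is written $\langle 0,1,\dots,k\rangle$. Its $p$-th face $\partial_p\sigma=\langle 0,\dots,p-1,p+1,\dots,k\rangle$ is the singular $(k-1)$-simplex obtained by restricting $\sigma$ to the face opposite vertex $p$. More generally, $\sigma|_{\langle i,\dots,j\rangle}$ is the singular $(j-i)$-simplex obtained by restricting $\sigma$ to the face of $\Delta^k$ spanned by vertices $i,\dots,j$ (identified with $\Delta^{j-i}$ by the order-preserving affine identification of vertices). For a singular simplex $\sigma$, $F_i$ denotes the fibre $p^{-1}(\sigma(i))\subset E$ over the image of its $i$-th vertex. For $1\le p\le k-1$, the initial vertex of $\partial_p\sigma$ is vertex $0$ of $\sigma$ and its last vertex is vertex $k$ of $\sigma$, so both sides of (3) lie in $F_k$. The letter $p$ denotes both the projection $E\to B$ and, in (3) and (4), an integer index. A representation up to homotopy of $Sing(B)$ on $E\to B$ is, by definition, a collection $\{\theta_k\}_{k\ge0}$ as described in the claim. *)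

(* Defs.v *)
From HB Require Import structures.
From mathcomp Require Import all_boot all_order all_algebra.
From mathcomp Require Import all_classical all_reals all_analysis.

Set Implicit Arguments.
Unset Strict Implicit.
Unset Printing Implicit Defensive.

Import Order.TTheory GRing.Theory Num.Theory.
Import numFieldNormedType.Exports.
Local Open Scope classical_set_scope.
Local Open Scope ring_scope.

(* Subsets such as [unitI R] or [fibre p b] are used as types through the
   coercion [set_type], which carries the subspace topology.  The cube I^n is
   ['rV[unitI R]_n]; its topology is the product topology, and the (n = 0)-cube
   is a point. *)

Definition unitI (R : realType) : set R := `[0, 1].
Arguments unitI : clear implicits.

Fact unitI_0 (R : realType) : (0 : R) \in unitI R.
Proof. by apply/mem_set; rewrite /unitI /= in_itv /= lexx ler01. Qed.

Fact unitI_1 (R : realType) : (1 : R) \in unitI R.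
Proof. by apply/mem_set; rewrite /unitI /= in_itv /= ler01 lexx. Qed.

Definition I0 (R : realType) : unitI R := exist _ 0 (@unitI_0 R).
Definition I1 (R : realType) : unitI R := exist _ 1 (@unitI_1 R).

Definition homotopic (R : realType) (X Y : topologicalType) (f g : X -> Y) :=
  exists H : X * unitI R -> Y,
    [/\ continuous H,
        forall x, H (x, I0 R) = f x
      & forall x, H (x, I1 R) = g x].

Definition homotopy_equivalence (R : realType) (X Y : topologicalType)
    (f : X -> Y) :=
  continuous f /\
  exists g : Y -> X,
    [/\ continuous g,
        homotopic R (g \o f) idfun
      & homotopic R (f \o g) idfun].

Definition homotopy_lifting_property (R : realType) (E B : topologicalType)
    (p : E -> B) :=
  forall (X : topologicalType) (h : X * unitI R -> B) (f : X -> E),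
    continuous h -> continuous f -> (forall x, p (f x) = h (x, I0 R)) ->
    exists H : X * unitI R -> E,
      [/\ continuous H,
          forall z, p (H z) = h z
        & forall x, H (x, I0 R) = f x].

Definition fibration (R : realType) (E B : topologicalType) (p : E -> B) :=
  continuous p /\ homotopy_lifting_property R p.

Definition simplex (R : realType) (k : nat) : set 'rV[R]_k.+1 :=
  [set x | (forall i, 0 <= x ord0 i) /\ \sum_i x ord0 i = 1].
Arguments simplex : clear implicits.

Section Simplices.
Variable R : realType.

Fact vertex_subproof k (i : 'I_k.+1) : delta_mx ord0 i \in simplex R k.
Proof.
apply/mem_set; split=> [j|]; first by rewrite mxE ler0n.
rewrite (bigD1 i) //= mxE !eqxx big1 ?addr0// => j ji.
by rewrite mxE (negbTE ji) andbF.
Qed.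

Definition vertex k (i : 'I_k.+1) : simplex R k :=
  exist _ (delta_mx ord0 i) (vertex_subproof i).

Definition affine_row m k (f : 'I_m.+1 -> 'I_k.+1) (x : 'rV[R]_m.+1) :
    'rV[R]_k.+1 := \row_j \sum_(i | f i == j) x ord0 i.

Fact affine_subproof m k (f : 'I_m.+1 -> 'I_k.+1) (x : simplex R m) :
  affine_row f (val x) \in simplex R k.
Proof.
case: x => x /= /set_mem[x0 x1]; apply/mem_set; split=> [j|].
  by rewrite mxE sumr_ge0.
rewrite -x1 (partition_big f predT) //=.
by apply: eq_bigr => j _; rewrite mxE.
Qed.

(* The affine map of simplices sending vertex i to vertex f i. *)
Definition affine m k (f : 'I_m.+1 -> 'I_k.+1) (x : simplex R m) :
    simplex R k :=
  exist _ (affine_row f (val x)) (affine_subproof f x).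

Lemma affine_vertex m k (f : 'I_m.+1 -> 'I_k.+1) (i : 'I_m.+1) :
  affine f (vertex i) = vertex (f i).
Proof.
apply: val_inj => /=; apply/rowP => j; rewrite !mxE /= [j == _]eq_sym.
have [<-|fij] := eqVneq (f i) j.
  rewrite (bigD1 i) //= mxE !eqxx big1 ?addr0// => l /andP[_ /negbTE li].
  by rewrite mxE li.
rewrite big1// => l /eqP flj; rewrite mxE.
by have [li|//] := eqVneq l i; rewrite -flj li eqxx in fij.
Qed.

Lemma affine_continuous m k (f : 'I_m.+1 -> 'I_k.+1) : continuous (affine f).
Proof.
apply: continuous_comp_initial => x.
apply: (@continuous_comp _ _ _ (val : simplex R m -> 'rV[R]_m.+1)
  (affine_row f)); first exact: initial_continuous.
move: (val x) => {}x A [P Px sPA].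
have H : nbhs x (fun y => forall j, P ord0 j (affine_row f y ord0 j)).
  apply: (@filter_forall _ _
    (fun j y => P ord0 j (affine_row f y ord0 j)) (nbhs x)) => j.
  have cj : {for x, continuous (fun y : 'rV[R]_m.+1 => affine_row f y ord0 j)}.
    rewrite (_ : (fun y => _) =
        \sum_(i | f i == j) (fun y : 'rV[R]_m.+1 => y ord0 i)).
      elim/big_ind : _ => [|g h cg ch|i _]; first exact: (@cst_continuous _ _ (0 : R)).
        exact: (@continuousD _ _ _ _ _ _ cg ch).
      exact: coord_continuous.
    by apply/funext => y; rewrite mxE fct_sumE.
  exact: cj (Px ord0 j).
by apply: filterS H => y Py; apply: sPA => i j; rewrite ord1; exact: Py.
Qed.

HB.instance Definition _ m k (f : 'I_m.+1 -> 'I_k.+1) :=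
  isContinuous.Build _ _ (affine f) (@affine_continuous m k f).

End Simplices.

Definition sing (R : realType) (B : topologicalType) (k : nat) :=
  continuousType (simplex R k) B.

Section SingularSimplices.
Variables (R : realType) (B : topologicalType).
Implicit Type k : nat.

Definition vtx k (s : sing R B k) (i : 'I_k.+1) : B := s (vertex R i).

Definition pull m k (f : 'I_m.+1 -> 'I_k.+1) (s : sing R B k) : sing R B m :=
  s \o affine f.

Lemma vtx_pull m k (f : 'I_m.+1 -> 'I_k.+1) (s : sing R B k) (i : 'I_m.+1) :
  vtx (pull f s) i = vtx s (f i).
Proof. by rewrite /vtx /pull /= affine_vertex. Qed.

(* The face opposite to vertex p. *)
Definition face k (p : 'I_k.+2) (s : sing R B k.+1) : sing R B k :=
  pull (lift p) s.

(* The restriction to <a, a + 1, ..., a + m>; meaningful for a + m <= k. *)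
Definition subsimplex a m k (s : sing R B k) : sing R B m :=
  pull (fun j : 'I_m.+1 => inord (a + j) : 'I_k.+1) s.

End SingularSimplices.

Definition fibre (E B : topologicalType) (p : E -> B) (b : B) : set E :=
  p @^-1` [set b].

Section Fibres.
Variables (E B : topologicalType) (p : E -> B).

Fact fibre_cast_subproof (b b' : B) (bb' : b = b') (e : fibre p b) :
  val e \in fibre p b'.
Proof. by rewrite -bb'; exact: valP. Qed.

(* The identification of the fibres over two provably equal points: it does
   not change the underlying point of E. *)
Definition fibre_cast (b b' : B) (bb' : b = b') (e : fibre p b) : fibre p b' :=
  exist _ (val e) (fibre_cast_subproof bb' e).

End Fibres.

(* In dimension k = n.+2, an index 1 <= p <= k - 1 is written p = i + 1 with
   i : 'I_n.+1, so that t_p is [t ord0 i] and q = k - p is (n - i).+1. *)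
Section Indices.
Variables (R : realType) (B : topologicalType) (n : nat).
Variables (s : sing R B n.+2) (i : 'I_n.+1).

Definition inner_face : sing R B n.+1 := face (inord i.+1) s.
Definition front : sing R B i.+1 := subsimplex 0 i.+1 s.
Definition back : sing R B (n - i).+1 := subsimplex i.+1 (n - i).+1 s.

Fact inner_lt : (i.+1 < n.+3)%N.
Proof. exact: leq_trans (ltn_ord i) (leqnSn n.+1). Qed.

Lemma vtx_inner_face_first : vtx s ord0 = vtx inner_face ord0.
Proof.
rewrite /inner_face /face vtx_pull; congr (vtx s _); apply: val_inj.
by rewrite /= /bump inordK ?inner_lt.
Qed.

Lemma vtx_front_first : vtx s ord0 = vtx front ord0.
Proof.
by rewrite /front /subsimplex vtx_pull; congr (vtx s _); apply: val_inj;
  rewrite /= inordK.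
Qed.

Lemma vtx_front_last : vtx front ord_max = vtx back ord0.
Proof. by rewrite /front /back /subsimplex !vtx_pull /= add0n addn0. Qed.

(* The last vertices of the simplices on the two sides of each equation also
   agree, so that both sides are points of the same fibre. *)
Lemma vtx_inner_face_last : vtx inner_face ord_max = vtx s ord_max.
Proof.
rewrite /inner_face /face vtx_pull; congr (vtx s _); apply: val_inj.
by rewrite /= /bump inordK ?inner_lt// ltn_ord.
Qed.

Lemma vtx_back_last : vtx back ord_max = vtx s ord_max.
Proof.
rewrite /back /subsimplex vtx_pull; congr (vtx s _); apply: val_inj.
by rewrite /= addSn addnS subnKC ?inordK// -ltnS.
Qed.

End Indices.

(* [theta0 s] is theta_0(s), and [theta k s] is theta_(k + 1)(s).  The two
   sides of an equation between points of fibres over provably equal points are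
   compared in E. *)
Record representation_up_to_homotopy (R : realType) (E B : topologicalType)
    (p : E -> B)
    (theta0 : forall s : sing R B 0,
       continuousType (fibre p (vtx s ord0)) (fibre p (vtx s ord0)))
    (theta : forall (k : nat) (s : sing R B k.+1),
       continuousType ('rV[unitI R]_k * fibre p (vtx s ord0))%type
                      (fibre p (vtx s ord_max))) : Prop := {
  theta0_id : forall (s : sing R B 0) (e : fibre p (vtx s ord0)),
    theta0 s e = e;
  theta_equivalence : forall (k : nat) (s : sing R B k.+1)
      (t : 'rV[unitI R]_k),
    homotopy_equivalence R (fun e : fibre p (vtx s ord0) => theta k s (t, e));
  theta_face : forall (n : nat) (s : sing R B n.+2) (i : 'I_n.+1)
      (t : 'rV[unitI R]_n.+1) (e : fibre p (vtx s ord0)),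
    t ord0 i = I0 R ->
    val (theta n.+1 s (t, e)) =
    val (theta n (inner_face s i)
           (col' i t, fibre_cast (vtx_inner_face_first s i) e));
  theta_comp : forall (n : nat) (s : sing R B n.+2) (i : 'I_n.+1)
      (t : 'rV[unitI R]_n.+1) (e : fibre p (vtx s ord0)),
    t ord0 i = I1 R ->
    val (theta n.+1 s (t, e)) =
    val (theta (n - i)%N (back s i)
           (\row_(j < n - i) t ord0 (inord (i.+1 + j)),
            fibre_cast (vtx_front_last s i)
              (theta i (front s i)
                 (\row_(j < i) t ord0 (inord j),
                  fibre_cast (vtx_front_first s i) e)))) }.

(* Main.v *)
Require Import Defs.
From HB Require Import structures.
From mathcomp Require Import all_boot all_order all_algebra.
From mathcomp Require Import all_classical all_reals all_analysis.
From mathcomp Require Import lra zify.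

Set Implicit Arguments.
Unset Strict Implicit.
Unset Printing Implicit Defensive.

Import Order.TTheory GRing.Theory Num.Theory.
Import numFieldNormedType.Exports.
Local Open Scope classical_set_scope.
Local Open Scope ring_scope.

(* One application of homotopy lifting, to the space of all pairs (e, c) with c
   a path starting at p e, gives a lift L e c u that depends on nothing but e, c
   and u, continuously in families, with L e c 0 = e.

   In the coordinates 1 >= x_1 >= ... >= x_k >= 0 on Delta^k, vertex j is
   (1, .., 1, 0, .., 0) with j ones.  For t in I^(k-1) let the coordinates run
   from 0 to 1 at unit speed, x_(j+1) starting t_j after x_j; this is a path from
   vertex 0 to vertex k.  If t_p = 0, then x_p = x_(p+1) and the path lies in the
   p-th face; if t_p = 1, then x_p is 1 when x_(p+1) starts, and the path is the
   concatenation of those of <0..p> and <p..k>.  Define theta_k(s)(t, e) by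
   lifting the path piece by piece, cutting it at the starting times of the
   coordinates: the pieces have lengths t_1, ..., t_(k-1), 1.  A piece of length
   t_p = 0 is lifted trivially, which gives (3), and a cut with t_p = 1 is the cut
   between <0..p> and <p..k>, which gives (4).  Scaling all the lengths by w in I
   shows that theta_k(s)(t, -) is the end of a lift of a path, whence (2). *)

(** * Continuity for subspaces, products, rows and real-valued functions *)

Lemma set_val_continuous (X : topologicalType) (A : set X) :
  continuous (val : A -> X).
Proof. exact: initial_continuous. Qed.

Lemma continuous_pair (X Y Z : topologicalType) (f : Z -> X) (g : Z -> Y) :
  continuous f -> continuous g -> continuous (fun z => (f z, g z)).
Proof. by move=> cf cg z; apply: cvg_pair; [exact: cf|exact: cg]. Qed.

Lemma continuous_compose (X Y Z : topologicalType) (f : X -> Y) (g : Y -> Z) :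
  continuous f -> continuous g -> continuous (fun x => g (f x)).
Proof. by move=> cf cg x; apply: continuous_comp; [exact: cf|exact: cg]. Qed.

Lemma continuous_fst (X Y : topologicalType) : continuous (@fst X Y).
Proof. by move=> x; exact: cvg_fst. Qed.

Lemma continuous_snd (X Y : topologicalType) : continuous (@snd X Y).
Proof. by move=> x; exact: cvg_snd. Qed.

Lemma continuous_cst (X Y : topologicalType) (y : Y) :
  continuous (fun _ : X => y).
Proof. by move=> x; exact: cvg_cst. Qed.

Lemma continuous_rowP (T Z : topologicalType) n (f : Z -> 'rV[T]_n) :
  (forall j, continuous (fun z => f z ord0 j)) -> continuous f.
Proof.
move=> cf z A [P Pz sPA].
have H : nbhs z (fun y => forall j, P ord0 j (f y ord0 j)).
  apply: (@filter_forall _ _ (fun j y => P ord0 j (f y ord0 j)) (nbhs z)) => j.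
  exact: cf (Pz ord0 j).
by apply: filterS H => y Py; apply: sPA => i j; rewrite ord1; exact: Py.
Qed.

Lemma row_coord_continuous (T : topologicalType) n (j : 'I_n) :
  continuous (fun x : 'rV[T]_n => x ord0 j).
Proof.
(* The box with [A] in coordinate [j] and the whole space elsewhere: the condition is vacuous when
   [k] differs from [j]. *)
move=> x A Ax; exists (fun i k => [set y | k = j -> A y]) => [i k|y yA].
  rewrite ord1; have [->|kj] := eqVneq k j; first by apply: (filterS _ Ax) => y /=.
  by apply: nearW => y /= /eqP; rewrite (negbTE kj).
exact: yA.
Qed.

Section RealValued.
Variables (R : realType) (Z : topologicalType).
Implicit Types f g : Z -> R.

Lemma continuous_add f g :
  continuous f -> continuous g -> continuous (fun z => f z + g z).
Proof. by move=> cf cg z; apply: cvgD; [exact: cf|exact: cg]. Qed.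

Lemma continuous_sub f g :
  continuous f -> continuous g -> continuous (fun z => f z - g z).
Proof. by move=> cf cg z; apply: cvgB; [exact: cf|exact: cg]. Qed.

Lemma continuous_mul f g :
  continuous f -> continuous g -> continuous (fun z => f z * g z).
Proof. by move=> cf cg z; apply: cvgM; [exact: cf|exact: cg]. Qed.

Lemma continuous_sum (I : Type) (r : seq I) (P : pred I) (f : I -> Z -> R) :
  (forall i, continuous (f i)) -> continuous (fun z => \sum_(i <- r | P i) f i z).
Proof.
move=> cf; elim: r => [|i r IH].
  rewrite (_ : (fun z => _) = fun=> 0); first exact: continuous_cst.
  by apply/funext => z; rewrite big_nil.
rewrite (_ : (fun z => _) = fun z => (if P i then f i z else 0) +
  \sum_(i <- r | P i) f i z); last first.
  by apply/funext => z; rewrite big_cons; case: (P i); rewrite ?add0r.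
apply: continuous_add IH; case: (P i); [exact: cf|exact: continuous_cst].
Qed.

End RealValued.

(** * Path lifting functions *)

Section PathLifting.
Variables (R : realType) (E B : topologicalType) (p : E -> B).

(** The retraction of the line onto $[0,1]$. It allows paths to be total functions on [R] and times
    to be plain reals. *)
Definition clamp (x : R) : R := Num.max 0 (Num.min 1 x).

Lemma clamp_unitI x : clamp x \in unitI R.
Proof.
by apply/mem_set; rewrite /unitI /= in_itv /= /clamp le_max lexx ge_max ler01
  ge_min lexx.
Qed.

Lemma clamp_ge0 x : 0 <= clamp x. Proof. by rewrite le_max lexx. Qed.

Lemma clamp_le1 x : clamp x <= 1. Proof. by rewrite ge_max ler01 ge_min lexx. Qed.

Lemma clamp_id x : 0 <= x -> x <= 1 -> clamp x = x.
Proof. by move=> x0 x1; rewrite /clamp (min_idPr x1) (max_idPr x0). Qed.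

Lemma clamp_eq0 x : x <= 0 -> clamp x = 0.
Proof. by move=> x0; apply/max_idPl; rewrite ge_min x0 orbT. Qed.

Lemma clamp_eq1 x : 1 <= x -> clamp x = 1.
Proof. by move=> x1; rewrite /clamp (min_idPl x1); apply/max_idPr. Qed.

Lemma clamp_le x y : x <= y -> clamp x <= clamp y.
Proof.
by move=> xy; rewrite /clamp ge_max le_max lexx /= le_max le_min !ge_min lexx xy
  orbT orbT.
Qed.

Lemma clamp_continuous : continuous clamp.
Proof.
move=> x; apply: continuous_max; first exact: cvg_cst.
by apply: continuous_min; [exact: cvg_cst|exact: cvg_id].
Qed.

Definition to_unitI (x : R) : unitI R := exist _ (clamp x) (clamp_unitI x).

Lemma to_unitI_continuous : continuous to_unitI.
Proof. by apply: continuous_comp_initial; exact: clamp_continuous. Qed.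

Lemma unitI_ge0 (t : unitI R) : 0 <= val t.
Proof. by case: t => t /= /set_mem; rewrite /unitI /= in_itv /= => /andP[]. Qed.

Lemma unitI_le1 (t : unitI R) : val t <= 1.
Proof. by case: t => t /= /set_mem; rewrite /unitI /= in_itv /= => /andP[]. Qed.

(* A lift depending only on the initial point and on the path, continuously in
   families; it is what makes lifts along equal paths equal. *)
Record path_lifting (L : E -> (R -> B) -> R -> E) : Prop := PathLifting {
  lift_start : forall e c, L e c 0 = e;
  lift_over : forall e c u, continuous c -> p e = c 0 -> 0 <= u -> u <= 1 ->
    p (L e c u) = c u;
  lift_eq : forall e c c' u, (forall x, 0 <= x -> x <= 1 -> c x = c' x) ->
    L e c u = L e c' u;
  lift_continuous : forall (Z : topologicalType) (f : Z -> E) (c : Z -> R -> B)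
      (u : Z -> R),
    continuous f -> continuous (fun zx : Z * R => c zx.1 zx.2) ->
    continuous u -> (forall z, p (f z) = c z 0) ->
    continuous (fun z => L (f z) (c z) (u z)) }.

(* The pairs [(e, c)] form a space on which evaluation of [c] is continuous, so
   that all path lifts come from one application of homotopy lifting. *)
Lemma fibration_path_lifting : fibration R p -> exists L, path_lifting L.
Proof.
move=> [cp hlp].
pose X : set (E * {compact-open, R -> B}) :=
  [set ec | continuous (ec.2 : R -> B) /\ p ec.1 = ec.2 0].
pose h (z : X * unitI R) : B := (val z.1).2 (val z.2).
pose f (x : X) : E := (val x).1.
have cf : continuous f.
  apply: (continuous_compose (f := val : X -> _) (g := fst)).
    exact: set_val_continuous.
  exact: continuous_fst.
have ch : continuous h.
  (* Evaluation of a path at a time is continuous for the compact-open topology because [R] is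
     locally compact and Hausdorff. *)
  have cu : continuous (uncurry (fun x : X => (val x).2 : R -> B)).
    apply: continuous_uncurry.
    - exact: locally_compactR.
    - exact: norm_hausdorff.
    - apply: (continuous_compose (f := val : X -> _) (g := snd)).
        exact: set_val_continuous.
      exact: continuous_snd.
    - by move=> x; have [] := set_mem (valP x).
  have -> : h = fun z : X * unitI R =>
      uncurry (fun x : X => (val x).2 : R -> B) (z.1, val z.2).
    by apply/funext => -[].
  apply: (continuous_compose _ cu); apply: continuous_pair.
    exact: continuous_fst.
  apply: (continuous_compose (@continuous_snd _ _)); exact: set_val_continuous.
have [|H [cH pH H0]] := hlp X h f ch cf.
  by move=> x; have [] := set_mem (valP x).
(* [L] is total: off [X] it returns [e], which is compatible with [lift_start]. Precomposing with
   [clamp] forgets [c] outside $[0,1]$, so paths that agree there give the same pair, whence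
   [lift_eq]. *)
exists (fun e c u => if insub (e, c \o clamp) is Some x
                     then H (x, to_unitI u) else e).
split.
- move=> e c; case: insubP => // x _ xE.
  have -> : to_unitI 0 = I0 R by apply: val_inj; rewrite /= clamp_id.
  by rewrite H0 /f xE.
- move=> e c u cc pe u0 u1; case: insubP => [x _ xE|].
    by rewrite pH /h /= xE /= !clamp_id ?clamp_ge0 ?clamp_le1.
  case/negP; apply/mem_set; split=> /=.
    exact: (continuous_compose clamp_continuous cc).
  by rewrite clamp_id.
- move=> e c c' u cc'; have -> // : c \o clamp = c' \o clamp.
  by apply/funext => x /=; rewrite cc' ?clamp_ge0 ?clamp_le1.
- move=> Z g c u cg cc cu pg.
  have Xg z : (g z, c z \o clamp) \in X.
    apply/mem_set; split=> /=; last by rewrite clamp_id.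
    apply: (continuous_compose _ cc (f := fun x => (z, clamp x))).
    by apply: continuous_pair; [exact: continuous_cst|exact: clamp_continuous].
  pose k z : X := exist _ (g z, c z \o clamp) (Xg z).
  rewrite (_ : (fun z => _) = fun z => H (k z, to_unitI (u z))); last first.
    apply/funext => z; case: insubP => [x _ xE|]; last by rewrite Xg.
    by congr (H (_, _)); apply: val_inj.
  (* By currying, a jointly continuous family of paths is a continuous map into the compact-open
     function space. *)
  have ck : continuous k.
    apply: continuous_comp_initial; apply: continuous_pair => //.
    rewrite (_ : (fun z => _) =
      curry (fun zx : Z * R => c zx.1 (clamp zx.2))) //.
    apply: continuous_curry_fun.
    apply: (continuous_compose _ cc (f := fun zx => (zx.1, clamp zx.2))).
    apply: continuous_pair; first exact: continuous_fst.
    exact: (continuous_compose (@continuous_snd _ _) clamp_continuous).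
  apply: (continuous_compose _ cH (f := fun z => (k z, to_unitI (u z)))).
  apply: continuous_pair => //.
  exact: (continuous_compose cu to_unitI_continuous).
Qed.

End PathLifting.

(** * Reversal, concatenation and composition of homotopies *)

Section Homotopy.
Variable R : realType.

Lemma homotopicC (X Y : topologicalType) (f g : X -> Y) :
  homotopic R f g -> homotopic R g f.
Proof.
move=> [H [cH H0 H1]]; exists (fun z => H (z.1, to_unitI (1 - val z.2))); split.
- apply: (continuous_compose _ cH (f := fun z : X * unitI R => (z.1, to_unitI (1 - val z.2)))).
  apply: continuous_pair; first exact: continuous_fst.
  apply: (continuous_compose _ (@to_unitI_continuous R)).
  apply: continuous_sub; first exact: continuous_cst.
  exact: (continuous_compose (@continuous_snd _ _) (@set_val_continuous _ _)).
- move=> x; rewrite -H1; congr (H (_, _)); apply: val_inj => /=.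
  by rewrite subr0 clamp_id.
- move=> x; rewrite -H0; congr (H (_, _)); apply: val_inj => /=.
  by rewrite subrr clamp_id.
Qed.

Lemma homotopic_trans (X Y : topologicalType) (f g h : X -> Y) :
  homotopic R f g -> homotopic R g h -> homotopic R f h.
Proof.
move=> [H [cH H0 H1]] [K [cK K0 K1]].
pose F (z : X * unitI R) := H (z.1, to_unitI (2 * val z.2)).
pose G (z : X * unitI R) := K (z.1, to_unitI (2 * val z.2 - 1)).
have cv : continuous (fun z : X * unitI R => val z.2).
  exact: (continuous_compose (@continuous_snd _ _) (@set_val_continuous _ _)).
have c2 : continuous (fun z : X * unitI R => 2 * val z.2).
  by apply: continuous_mul => //; exact: continuous_cst.
have cF : continuous F.
  apply: (continuous_compose _ cH (f := fun z : X * unitI R => (z.1, to_unitI (2 * val z.2)))).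
  apply: continuous_pair; first exact: continuous_fst.
  exact: (continuous_compose c2 (@to_unitI_continuous R)).
have cG : continuous G.
  apply: (continuous_compose _ cK
    (f := fun z : X * unitI R => (z.1, to_unitI (2 * val z.2 - 1)))).
  apply: continuous_pair; first exact: continuous_fst.
  apply: (continuous_compose _ (@to_unitI_continuous R)).
  by apply: continuous_sub => //; exact: continuous_cst.
pose P (z : X * unitI R) := if 2 * val z.2 <= 1 then F z else G z.
exists P; split.
- have PF z : 2 * val z.2 <= 1 -> P z = F z by rewrite /P => ->.
  have PG z : 1 <= 2 * val z.2 -> P z = G z.
    rewrite /P le_eqVlt => /orP[/eqP e|]; last by rewrite ltNge => /negbTE ->.
    rewrite -e lexx /F /G -e subrr.
    have -> : to_unitI 1 = I1 R by apply: val_inj; rewrite /= clamp_id.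
    have -> : to_unitI 0 = I0 R by apply: val_inj; rewrite /= clamp_id.
    by rewrite H1 K0.
  (* Pasting over two closed halves that cover the cylinder; [PF] and [PG] say that the two formulas
     agree on the overlap. *)
  pose A := [set z : X * unitI R | 2 * val z.2 <= 1].
  pose A' := [set z : X * unitI R | 1 <= 2 * val z.2].
  have AT : A `|` A' = setT.
    by apply/seteqP; split=> // z _; apply/orP; exact: le_total.
  apply/continuous_subspace_setT; rewrite -AT.
  apply: withinU_continuous.
  + apply: (preimage_closed (f := fun z : X * unitI R => 2 * val z.2)
      _ (@closed_le R 1)); exact: in1W.
  + apply: (preimage_closed (f := fun z : X * unitI R => 2 * val z.2)
      _ (@closed_ge R 1)); exact: in1W.
  + apply: (@subspace_eq_continuous _ _ _ F); last exact: continuous_subspaceT.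
    by move=> z /set_mem Az; exact/esym/PF.
  + apply: (@subspace_eq_continuous _ _ _ G); last exact: continuous_subspaceT.
    by move=> z /set_mem Az; exact/esym/PG.
- move=> x; rewrite /P /F /= mulr0 ler01 -H0.
  by congr (H (_, _)); apply: val_inj => /=; rewrite clamp_id.
- move=> x; rewrite /P /G /= mulr1 -K1 ifF; last first.
    by apply/negbTE; rewrite -ltNge ltr1n.
  congr (K (_, _)); apply: val_inj => /=.
  by rewrite clamp_id// -[2]/(1 + 1) addrK.
Qed.

Lemma homotopic_precomp (X Y Z : topologicalType) (k : X -> Y) (f g : Y -> Z) :
  continuous k -> homotopic R f g -> homotopic R (f \o k) (g \o k).
Proof.
move=> ck [H [cH H0 H1]]; exists (fun z => H (k z.1, z.2)).
split=> [|x|x] /=.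
- apply: (continuous_compose _ cH (f := fun z : X * unitI R => (k z.1, z.2))).
  apply: continuous_pair; last exact: continuous_snd.
  exact: (continuous_compose (@continuous_fst _ _) ck).
- exact: H0.
- exact: H1.
Qed.

Lemma homotopic_postcomp (X Y Z : topologicalType) (k : Y -> Z) (f g : X -> Y) :
  continuous k -> homotopic R f g -> homotopic R (k \o f) (k \o g).
Proof.
move=> ck [H [cH H0 H1]]; exists (k \o H); split=> [|x|x] /=.
- exact: (continuous_compose cH ck).
- by rewrite H0.
- by rewrite H1.
Qed.

(** The homotopy inverse [g] of [f] also serves [f'], since composition respects homotopy. *)
Lemma homotopic_equivalence (X Y : topologicalType) (f f' : X -> Y) :
  continuous f' -> homotopic R f' f ->
  homotopy_equivalence R f -> homotopy_equivalence R f'.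
Proof.
move=> cf' f'f [cf [g [cg gf fg]]]; split=> //; exists g; split=> //.
- exact: homotopic_trans (homotopic_postcomp cg f'f) gf.
- exact: homotopic_trans (homotopic_precomp cg f'f) fg.
Qed.

End Homotopy.

(** * Transport between fibres along a path is a homotopy equivalence *)

Section FibreTransport.
Variables (R : realType) (E B : topologicalType) (p : E -> B).
Variable L : E -> (R -> B) -> R -> E.
Hypothesis pL : path_lifting p L.

Lemma fibreP b (e : fibre p b) : p (val e) = b.
Proof. exact: set_mem (valP e). Qed.

(** By the subspace topology, a homotopy in [E] that stays over [b] is one in the fibre; homotopies
    can thus be written directly with [L]. *)
Lemma homotopic_fibre (X : topologicalType) (b : B) (f g : X -> fibre p b)
    (H : X * unitI R -> E) :
  continuous H -> (forall z, p (H z) = b) ->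
  (forall x, H (x, I0 R) = val (f x)) -> (forall x, H (x, I1 R) = val (g x)) ->
  homotopic R f g.
Proof.
move=> cH pH H0 H1.
have Hb z : H z \in fibre p b by apply/mem_set; exact: pH.
exists (fun z => exist _ (H z) (Hb z)); split=> [|x|x].
- by apply: continuous_comp_initial; exact: cH.
- by apply: val_inj; exact: H0.
- by apply: val_inj; exact: H1.
Qed.

(* At time w, follow c up to time max(0, 2w - 1) and come back: the (s, u)
   with s (1 - u) = 0 form an arc from (0, 0) to (1, 1) along which the endpoint
   of the return trip stays over c 0. *)
Lemma lift_back_homotopic (c : R -> B) (b0 b1 : B)
    (f : fibre p b0 -> fibre p b1) (g : fibre p b1 -> fibre p b0) :
  continuous c -> c 0 = b0 ->
  (forall e, val (f e) = L (val e) c 1) ->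
  (forall e, val (g e) = L (val e) (fun x => c (1 - x)) 1) ->
  homotopic R (g \o f) idfun.
Proof.
move=> cc c0 fE gE; apply: homotopicC.
pose s (z : fibre p b0 * unitI R) := clamp (2 * val z.2 - 1).
pose u (z : fibre p b0 * unitI R) := clamp (2 * val z.2).
have cv : continuous (fun z : fibre p b0 * unitI R => 2 * val z.2).
  apply: continuous_mul; first exact: continuous_cst.
  exact: (continuous_compose (@continuous_snd _ _) (@set_val_continuous _ _)).
have cu : continuous u by exact: (continuous_compose cv (@clamp_continuous R)).
have cs : continuous s.
  apply: (continuous_compose _ (@clamp_continuous R)).
  by apply: continuous_sub => //; exact: continuous_cst.
have su z : s z * (1 - u z) = 0.
  have [z1|z1] := leP (2 * val z.2) 1.
    by rewrite /s clamp_eq0 ?mul0r// subr_le0.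
  by rewrite /u [clamp (2 * _)]clamp_eq1 ?subrr ?mulr0// ltW.
have ve : continuous (fun z : fibre p b0 * unitI R => val z.1).
  exact: (continuous_compose (@continuous_fst _ _) (@set_val_continuous _ _)).
have pe (e : fibre p b0) : p (val e) = c 0 by rewrite fibreP c0.
have pls z : p (L (val z.1) c (s z)) = c (s z * (1 - 0)).
  by rewrite (lift_over pL) ?clamp_ge0 ?clamp_le1// subr0 mulr1.
apply: (homotopic_fibre (H := fun z : fibre p b0 * unitI R =>
  L (L (val z.1) c (s z)) (fun x => c (s z * (1 - x))) (u z))).
- apply: (lift_continuous pL) => //.
    apply: (lift_continuous pL (c := fun _ => c)) => //.
    exact: (continuous_compose (@continuous_snd _ _) cc).
  apply: (continuous_compose _ cc
    (f := fun zx : (fibre p b0 * unitI R) * R => s zx.1 * (1 - zx.2))).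
  apply: continuous_mul.
    exact: (continuous_compose (@continuous_fst _ _) cs).
  by apply: continuous_sub; [exact: continuous_cst|exact: continuous_snd].
- move=> z; rewrite (lift_over pL) ?clamp_ge0 ?clamp_le1 ?su ?c0//.
  apply: (continuous_compose _ cc (f := fun x : R => s z * (1 - x))).
  apply: continuous_mul; first exact: continuous_cst.
  by apply: continuous_sub; [exact: continuous_cst|move=> x].
- move=> e /=; rewrite /s /u /= mulr0 sub0r !clamp_eq0 ?lerN10//.
  by rewrite !(lift_start pL).
- move=> e /=; rewrite gE fE /s /u /= mulr1 -[2]/(1 + 1) addrK.
  rewrite !clamp_eq1 ?lerDl//; congr (L _ _ _).
  by apply/funext => x; rewrite mul1r.
Qed.

(** The inverse lifts the reversed path. Reversing twice gives [c] back, so [lift_back_homotopic]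
    handles both composites. *)
Lemma lift_equivalence (c : R -> B) (b0 b1 : B) (f : fibre p b0 -> fibre p b1) :
  continuous c -> c 0 = b0 -> c 1 = b1 ->
  (forall e, val (f e) = L (val e) c 1) -> homotopy_equivalence R f.
Proof.
move=> cc c0 c1 fE.
pose c' x := c (1 - x).
have cc' : continuous c'.
  apply: (continuous_compose _ cc (f := fun x : R => 1 - x)).
  by apply: continuous_sub; [exact: continuous_cst|move=> x].
have gP (e : fibre p b1) : L (val e) c' 1 \in fibre p b0.
  apply/mem_set; rewrite /fibre /= (lift_over pL) ?ler01//.
    by rewrite /c' subrr.
  by rewrite fibreP /c' subr0.
pose g (e : fibre p b1) : fibre p b0 := exist _ (L (val e) c' 1) (gP e).
have cont_lift b (d : R -> B) : continuous d -> d 0 = b ->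
    continuous (fun e : fibre p b => L (val e) d 1).
  move=> cd d0; apply: (lift_continuous pL (c := fun _ => d)).
  - exact: set_val_continuous.
  - exact: (continuous_compose (@continuous_snd _ _) cd).
  - exact: continuous_cst.
  - by move=> e; rewrite fibreP.
split.
  apply: continuous_comp_initial.
  by rewrite (_ : _ \o f = fun e => L (val e) c 1);
    [exact: cont_lift|exact/funext].
exists g; split.
- apply: continuous_comp_initial; apply: cont_lift => //.
  by rewrite /c' subr0.
- exact: (lift_back_homotopic cc).
- apply: (lift_back_homotopic cc') => //; first by rewrite /c' subr0.
  move=> e; rewrite fE; congr (L _ _ _).
  by apply/funext => x; rewrite /c' opprB addrC subrK.
Qed.

(** [G] may differ from the lift given by [L]. Following [G] up to time [w] and then [L] along the
    rest of [c] always ends over [c 1]; this joins transport by [L], at $w=0$, to [f], at $w=1$. *)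
Lemma lifted_homotopy_equivalence (c : R -> B) (b0 b1 : B)
    (G : fibre p b0 * unitI R -> E) (f : fibre p b0 -> fibre p b1) :
  continuous c -> c 0 = b0 -> c 1 = b1 -> continuous G ->
  (forall z, p (G z) = c (val z.2)) -> (forall e, G (e, I0 R) = val e) ->
  (forall e, val (f e) = G (e, I1 R)) -> homotopy_equivalence R f.
Proof.
move=> cc c0 c1 cG pG G0 G1.
have f0P (e : fibre p b0) : L (val e) c 1 \in fibre p b1.
  apply/mem_set; rewrite /fibre /= (lift_over pL) ?ler01//.
  by rewrite fibreP.
pose f0 (e : fibre p b0) : fibre p b1 := exist _ (L (val e) c 1) (f0P e).
have f0E : homotopy_equivalence R f0 by exact: (lift_equivalence cc).
apply: (homotopic_equivalence _ _ f0E).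
  apply: continuous_comp_initial.
  rewrite (_ : _ \o f = fun e => G (e, I1 R)); last exact/funext.
  apply: (continuous_compose _ cG (f := fun e : fibre p b0 => (e, I1 R))).
  by apply: continuous_pair; [move=> x|exact: continuous_cst].
apply: homotopicC.
have cv : continuous (fun z : fibre p b0 * unitI R => val z.2).
  exact: (continuous_compose (@continuous_snd _ _) (@set_val_continuous _ _)).
apply: (homotopic_fibre (H := fun z : fibre p b0 * unitI R =>
  L (G z) (fun x : R => c (val z.2 + x)) (1 - val z.2))).
- apply: (lift_continuous pL) => //.
  + apply: (continuous_compose _ cc
      (f := fun zx : (fibre p b0 * unitI R) * R => val zx.1.2 + zx.2)).
    apply: continuous_add; last exact: continuous_snd.
    exact: (continuous_compose (@continuous_fst _ _) cv).
  + by apply: continuous_sub => //; exact: continuous_cst.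
  + by move=> z; rewrite addr0.
- move=> z; rewrite (lift_over pL).
  + by rewrite addrC subrK.
  + apply: (continuous_compose _ cc (f := fun x : R => val z.2 + x)).
    by apply: continuous_add; [exact: continuous_cst|move=> x].
  + by rewrite addr0.
  + by rewrite subr_ge0 unitI_le1.
  + by rewrite lerBlDr lerDl unitI_ge0.
- move=> e; rewrite G0 /= subr0; apply: (lift_eq pL) => x _ _.
  by rewrite add0r.
- by move=> e; rewrite subrr (lift_start pL) G1.
Qed.

End FibreTransport.

(** * Lifting a path in successive pieces *)

Section SuccessiveLifts.
Variables (R : realType) (E B : topologicalType) (p : E -> B).
Variable L : E -> (R -> B) -> R -> E.
Hypothesis pL : path_lifting p L.
Implicit Types (T : nat -> R) (c : R -> B) (e : E).

(** The starting time of piece [m]. Pieces are counted from 0, so [T j] stands for $t_{j+1}$. *)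
Definition delay T m : R := \sum_(j < m) T j.

Lemma delay0 T : delay T 0 = 0. Proof. exact: big_ord0. Qed.

Lemma delayS T m : delay T m.+1 = delay T m + T m.
Proof. exact: big_ord_recr. Qed.

Lemma delayD T m n : delay T (m + n) = delay T m + delay (fun j => T (m + j)%N) n.
Proof. exact: big_split_ord. Qed.

Lemma eq_delay T T' m : (forall j, (j < m)%N -> T j = T' j) ->
  delay T m = delay T' m.
Proof. by move=> TT'; apply: eq_bigr => j _; exact: TT'. Qed.

Lemma delay_le T m n : (forall j, 0 <= T j) -> (m <= n)%N ->
  delay T m <= delay T n.
Proof.
by move=> T0 /subnKC <-; rewrite delayD lerDl; apply: sumr_ge0.
Qed.

(** Skipping the index [i] drops only the term [T i], which vanishes. At [m = i] the right side
    already contains this term. *)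
Lemma delay_bump T i m : T i = 0 ->
  delay (fun j => T (bump i j)) m = delay T (bump i m).
Proof.
move=> Ti; elim: m => [|m IH].
  rewrite delay0 /bump leqn0; case: eqP Ti => [->|_] Ti.
    by rewrite addn0 /= delayS delay0 Ti addr0.
  by rewrite delay0.
rewrite delayS IH /bump; have [im|mi] := leqP i m.
  by rewrite (leqW im) !add1n [RHS]delayS.
have [im|mi'] := leqP i m.+1; last by rewrite !add0n [RHS]delayS.
have {}im : i = m.+1 by apply/eqP; rewrite eqn_leq im.
by rewrite add0n add1n !delayS -im Ti addr0.
Qed.

Fixpoint lifts c T e m : E :=
  if m is m'.+1 then L (lifts c T e m') (fun x => c (delay T m' + x)) (T m')
  else e.

Lemma liftsS c T e m :
  lifts c T e m.+1 = L (lifts c T e m) (fun x => c (delay T m + x)) (T m).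
Proof. by []. Qed.

Lemma liftsD c T e m n :
  lifts c T e (m + n) =
  lifts (fun x => c (delay T m + x)) (fun j => T (m + j)%N) (lifts c T e m) n.
Proof.
elim: n => [|n IH]; first by rewrite addn0.
rewrite addnS /= IH; apply: (lift_eq pL) => x _ _.
by rewrite delayD addrA.
Qed.

(** Agreement is asked on a window of length 1 after each starting time, rather than of length
    [T j]: by [lift_eq], a lift up to [T j] is only known to be determined by the path on all of
    $[0,1]$. *)
Lemma lifts_eq c c' T T' e m :
  (forall j, (j < m)%N -> T j = T' j) ->
  (forall j x, (j < m)%N -> 0 <= x -> x <= 1 ->
     c (delay T j + x) = c' (delay T j + x)) ->
  lifts c T e m = lifts c' T' e m.
Proof.
elim: m => // m IH TT' cc' /=; rewrite IH.
- rewrite TT'//; apply: (lift_eq pL) => x x0 x1.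
  rewrite -(@eq_delay T T') ?cc'// => j jm.
  by apply: TT'; exact: leqW.
- by move=> j jm; apply: TT'; exact: leqW.
- by move=> j x jm; apply: cc'; exact: leqW.
Qed.

(** Piece [i] has length 0, so [lift_start] makes its lift trivial and it delays no later piece; it
    can be deleted. *)
Lemma lifts_bump c T e i m : T i = 0 -> (i <= m)%N ->
  lifts c T e m.+1 = lifts c (fun j => T (bump i j)) e m.
Proof.
move=> Ti; elim: m => [|m IH].
  by rewrite leqn0 => /eqP i0; rewrite /= -i0 Ti (lift_start pL).
rewrite leq_eqVlt => /orP[/eqP im|im].
  rewrite liftsS -im Ti (lift_start pL); apply: lifts_eq => // j.
  by rewrite /bump ltnNge => /negbTE ->.
rewrite [RHS]liftsS -IH// [LHS]liftsS delay_bump //.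
by rewrite /bump -ltnS im add1n.
Qed.

Lemma lifts_null c T e m : (forall j, T j = 0) -> lifts c T e m = e.
Proof. by move=> T0; elim: m => // m IH /=; rewrite T0 (lift_start pL). Qed.

Lemma lifts_over c T e m : continuous c -> (forall j, 0 <= T j) ->
  (forall j, T j <= 1) -> p e = c 0 -> p (lifts c T e m) = c (delay T m).
Proof.
move=> cc T0 T1 pe; elim: m => [|m IH] /=; first by rewrite delay0.
rewrite (lift_over pL) ?delayS ?addr0//.
apply: (continuous_compose _ cc (f := fun x : R => delay T m + x)).
by apply: continuous_add; [exact: continuous_cst|move=> x].
Qed.

Lemma delay_continuous (Z : topologicalType) (T : Z -> nat -> R) m :
  (forall j, continuous (fun z => T z j)) -> continuous (fun z => delay (T z) m).
Proof. by move=> cT; apply: continuous_sum => j; exact: cT. Qed.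

Lemma lifts_continuous (Z : topologicalType) (f : Z -> E) (c : Z -> R -> B)
    (T : Z -> nat -> R) m :
  continuous f -> continuous (fun zx : Z * R => c zx.1 zx.2) ->
  (forall j, continuous (fun z => T z j)) ->
  (forall z j, 0 <= T z j) -> (forall z j, T z j <= 1) ->
  (forall z, p (f z) = c z 0) ->
  continuous (fun z => lifts (c z) (T z) (f z) m).
Proof.
move=> cf cc cT T0 T1 pf; elim: m => [|m IH] //=.
apply: (lift_continuous pL) => //.
- apply: (continuous_compose _ cc
    (f := fun zx : Z * R => (zx.1, delay (T zx.1) m + zx.2))).
  apply: continuous_pair; first exact: continuous_fst.
  apply: continuous_add; last exact: continuous_snd.
  apply: (continuous_compose (@continuous_fst _ _)
    (g := fun z => delay (T z) m)).
  exact: delay_continuous.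
- move=> z; rewrite lifts_over ?addr0//.
  apply: (continuous_compose _ cc (f := fun x : R => (z, x))).
  by apply: continuous_pair; [exact: continuous_cst|move=> x].
Qed.

End SuccessiveLifts.

(** * Paths in the simplex, in order coordinates *)

Section SimplexPath.
Variable R : realType.

(* The order coordinate x_j of the header is [tail _ j]; in these terms an affine
   map given by a monotone map of vertices just repeats or drops coordinates. *)
Definition tail n (x : 'rV[R]_n) j : R := \sum_(i < n | (j <= i)%N) x ord0 i.

Lemma tail_inj n (x y : 'rV[R]_n) : tail x =1 tail y -> x = y.
Proof.
move=> xy; apply/rowP => i.
have tE (z : 'rV[R]_n) : z ord0 i = tail z i - tail z i.+1.
  apply/eqP; rewrite eq_sym subr_eq /tail (bigD1 i) //=; apply/eqP; congr (_ + _).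
  by apply: eq_bigl => j; rewrite ltn_neqAle andbC eq_sym.
by rewrite !tE !xy.
Qed.

(** The hypothesis says that the vertices sent by [f] to [j] or beyond are those from [l] on, and
    [affine_row] adds up weights over preimages. *)
Lemma tail_affine m k (f : 'I_m.+1 -> 'I_k.+1) (x : 'rV[R]_m.+1) j l :
  (forall i, (j <= f i)%N = (l <= i)%N) -> tail (affine_row f x) j = tail x l.
Proof.
move=> fP; rewrite /tail -(eq_bigl _ _ fP).
rewrite (partition_big f (fun i : 'I_k.+1 => (j <= i)%N)) //=.
apply: eq_bigr => i ji; rewrite mxE; apply: eq_bigl => a.
by case: eqP => [->|]; rewrite ?ji ?andbF.
Qed.

Lemma tail_vertex k (i : 'I_k.+1) j :
  tail (val (vertex R i)) j = ((j <= i)%N)%:R.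
Proof.
rewrite /tail big_mkcond (bigD1 i) //= mxE !eqxx big1 ?addr0; first by case: ifP.
by move=> l li; rewrite mxE (negbTE li) andbF if_same.
Qed.

(** Index 0 is the total weight 1, index [j'.+1] is the coordinate that starts at [delay T j'], and
    beyond [k.+1] the tail is an empty sum. *)
Definition order_coord k (T : nat -> R) (x : R) (j : nat) : R :=
  if j is j'.+1 then if (j' <= k)%N then clamp (x - delay T j') else 0 else 1.

Lemma order_coord_le k T x j : (forall j, 0 <= T j) ->
  order_coord k T x j.+1 <= order_coord k T x j.
Proof.
move=> T0; case: j => [|j] /=; first exact: clamp_le1.
case: ifP => jk; last by case: ifP => // _; exact: clamp_ge0.
rewrite (ltnW jk); apply: clamp_le.
by rewrite lerB// delay_le.
Qed.

Definition order_row k T x : 'rV[R]_k.+2 :=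
  \row_i (order_coord k T x i - order_coord k T x i.+1).

Lemma tail_order_row k T x : tail (order_row k T x) =1 order_coord k T x.
Proof.
move=> j; rewrite /tail.
under eq_bigr do rewrite mxE.
rewrite -(big_geq_mkord _ _ predT
  (fun i => order_coord k T x i - order_coord k T x i.+1)).
have [jk|kj] := leqP j k.+2; last first.
  rewrite big_geq ?(ltnW kj)//; case: j kj => //= j; rewrite ltnS => kj.
  by rewrite leqNgt (leq_trans _ kj).
(* The boundary term at [k.+2] is 0, so the telescoping sum leaves only the coordinate of index
   [j]. *)
rewrite (telescope_sumr_eq (fun i => - order_coord k T x i)) //.
  by rewrite /= ltnn oppr0 sub0r opprK.
by move=> i _; rewrite opprK addrC.
Qed.

Lemma order_row_simplex k T x : (forall j, 0 <= T j) ->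
  order_row k T x \in simplex R k.+1.
Proof.
move=> T0; apply/mem_set; split=> [i|].
  by rewrite mxE subr_ge0 order_coord_le.
by rewrite -[RHS]/(order_coord k T x 0) -tail_order_row.
Qed.

(* The last piece has length 1, hence the default value. *)
Definition times k (t : 'rV[unitI R]_k) (j : nat) : R :=
  if insub j is Some i then val (t ord0 i) else 1.

Lemma times_ge0 k (t : 'rV[unitI R]_k) j : 0 <= times t j.
Proof. by rewrite /times; case: insubP => // i _ _; exact: unitI_ge0. Qed.

Lemma times_le1 k (t : 'rV[unitI R]_k) j : times t j <= 1.
Proof. by rewrite /times; case: insubP => // i _ _; exact: unitI_le1. Qed.

Lemma times_ord k (t : 'rV[unitI R]_k) (i : 'I_k) : times t i = val (t ord0 i).
Proof. by rewrite /times valK. Qed.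

Lemma times_last k (t : 'rV[unitI R]_k) j : (k <= j)%N -> times t j = 1.
Proof. by move=> kj; rewrite /times insubN // -leqNgt. Qed.

Lemma times_continuous k j : continuous (fun t : 'rV[unitI R]_k => times t j).
Proof.
rewrite /times; case: insubP => [i _ _|_]; last exact: continuous_cst.
apply: (continuous_compose (@row_coord_continuous _ _ i)).
exact: set_val_continuous.
Qed.

Definition simplex_path k (t : 'rV[unitI R]_k) (x : R) : simplex R k.+1 :=
  exist _ (order_row k (times t) x) (order_row_simplex k x (times_ge0 t)).

Lemma simplex_path_continuous k : continuous (fun tx : 'rV[unitI R]_k * R =>
  simplex_path tx.1 tx.2).
Proof.
apply: continuous_comp_initial; apply: continuous_rowP => i.
rewrite (_ : (fun z => _) = fun tx : 'rV[unitI R]_k * R =>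
  order_coord k (times tx.1) tx.2 i - order_coord k (times tx.1) tx.2 i.+1);
  last by apply/funext => z /=; rewrite mxE.
have cj j : continuous (fun tx : 'rV[unitI R]_k * R =>
    order_coord k (times tx.1) tx.2 j).
  case: j => [|j] /=; first exact: continuous_cst.
  case: (j <= k)%N; last exact: continuous_cst.
  apply: (continuous_compose _ (@clamp_continuous R)
    (f := fun tx : 'rV[unitI R]_k * R => tx.2 - delay (times tx.1) j)).
  apply: continuous_sub; first exact: continuous_snd.
  apply: (continuous_compose (@continuous_fst _ _)
    (g := fun t : 'rV[unitI R]_k => delay (times t) j)).
  by apply: delay_continuous => l; exact: times_continuous.
exact: continuous_sub.
Qed.

Lemma simplex_path0 k (t : 'rV[unitI R]_k) :
  simplex_path t 0 = vertex R ord0.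
Proof.
apply: val_inj; apply: tail_inj => j; rewrite tail_order_row tail_vertex.
case: j => //= j; case: ifP => // _; rewrite clamp_eq0// sub0r oppr_le0.
by apply: sumr_ge0 => i _; exact: times_ge0.
Qed.

Lemma simplex_path_end k (t : 'rV[unitI R]_k) :
  simplex_path t (delay (times t) k.+1) = vertex R ord_max.
Proof.
apply: val_inj; apply: tail_inj => j; rewrite tail_order_row tail_vertex.
case: j => //= j; rewrite ltnS; case: ifP => // jk.
(* The last piece has length 1 and no coordinate starts after its beginning, so all have reached 1
   at its end. *)
rewrite clamp_eq1// delayS times_last// -addrAC lerDr subr_ge0.
by apply: delay_le => // l; exact: times_ge0.
Qed.

Lemma times_col' n (t : 'rV[unitI R]_n.+1) (i : 'I_n.+1) j :
  times (col' i t) j = times t (bump i j).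
Proof.
have [jn|nj] := ltnP j n.
  have -> : j = Ordinal jn by [].
  by rewrite times_ord mxE -times_ord.
rewrite !times_last// /bump (leq_trans _ nj) ?add1n ?ltnS//.
by rewrite -ltnS ltn_ord.
Qed.

Lemma times_front n (t : 'rV[unitI R]_n.+1) (i : 'I_n.+1) j :
  t ord0 i = I1 R -> (j < i.+1)%N ->
  times (\row_(l < i) t ord0 (inord l)) j = times t j.
Proof.
move=> ti; rewrite ltnS leq_eqVlt => /orP[/eqP ->|ji].
  by rewrite times_last// times_ord ti.
have -> : j = Ordinal ji by [].
rewrite times_ord mxE -times_ord inordK //=.
by rewrite ltnS ltnW// (leq_trans ji)// -ltnS ltn_ord.
Qed.

Lemma times_back n (t : 'rV[unitI R]_n.+1) (i : 'I_n.+1) j :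
  times (\row_(l < n - i) t ord0 (inord (i.+1 + l))) j = times t (i.+1 + j)%N.
Proof.
have [jn|nj] := ltnP j (n - i).
  have -> : j = Ordinal jn by [].
  rewrite times_ord mxE -times_ord inordK //=.
  by rewrite addSn ltnS -ltn_subRL.
by rewrite !times_last// addSn ltnS -leq_subLR.
Qed.

(** When [T i = 0], the coordinates [i.+1] and [i.+2] start together. The conditional is the
    codegeneracy that takes the value [i.+1] twice. *)
Lemma order_coord_bump k T i x j : T i = 0 -> (i <= k)%N ->
  order_coord k (fun l => T (bump i l)) x (if (j <= i.+1)%N then j else j.-1) =
  order_coord k.+1 T x j.
Proof.
move=> Ti ik; case: j => [//|j]; rewrite ltnS; have [ji|ij] := leqP j i.
  rewrite /= delay_bump// (leq_trans ji ik) (leq_trans ji (leqW ik)).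
  rewrite /bump; have [ij|//] := leqP i j.
  have -> : j = i by apply/eqP; rewrite eqn_leq ji.
  by rewrite add1n delayS Ti addr0.
case: j ij => [//|j]; rewrite ltnS => ij.
by rewrite /= ltnS delay_bump// /bump ij.
Qed.

(** The adjunction between a coface and a codegeneracy, in the form that [tail_affine] requires. *)
Lemma leq_bump_succ i j l :
  (j <= bump i.+1 l)%N = ((if (j <= i.+1)%N then j else j.-1) <= l)%N.
Proof.
rewrite /bump; have [il|li] := ltnP i l; have [ji|ij] := leqP j i.+1 => /=; lia.
Qed.

Lemma simplex_path_face n (t : 'rV[unitI R]_n.+1) (i : 'I_n.+1) (x : R) :
  t ord0 i = I0 R ->
  affine (lift (inord i.+1)) (simplex_path (col' i t) x) = simplex_path t x.
Proof.
move=> ti; apply: val_inj; apply: tail_inj => j; rewrite tail_order_row.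
have Ti : times t i = 0 by rewrite times_ord ti.
rewrite (@tail_affine _ _ _ _ _ (if (j <= i.+1)%N then j else j.-1)).
  rewrite tail_order_row.
  have -> : times (col' i t) = fun l => times t (bump i l).
    by apply/funext => l; exact: times_col'.
  by rewrite order_coord_bump// -ltnS.
by move=> l; rewrite /= inordK ?inner_lt// leq_bump_succ.
Qed.

Lemma simplex_path_front n (t : 'rV[unitI R]_n.+1) (i : 'I_n.+1) (x : R) :
  t ord0 i = I1 R -> x <= delay (times t) i.+1 ->
  affine (fun j : 'I_i.+2 => inord (0 + j) : 'I_n.+3)
    (simplex_path (\row_(l < i) t ord0 (inord l)) x) = simplex_path t x.
Proof.
move=> ti xi; apply: val_inj; apply: tail_inj => j; rewrite tail_order_row.
rewrite (@tail_affine _ _ _ _ _ j).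
  rewrite tail_order_row; case: j => //= j; have [ji|ij] := leqP j i.
    rewrite (leq_trans ji) ?(ltnW (ltn_ord i))//.
    rewrite (@eq_delay _ _ (times t))// => l lj.
    by rewrite times_front// (leq_trans lj)// ltnW.
  (* A coordinate of index above [i.+1] starts no earlier than the cut, so it is still 0. *)
  case: ifP => // _; rewrite clamp_eq0// subr_le0 (le_trans xi)//.
  by apply: delay_le => // l; exact: times_ge0.
by move=> l; rewrite add0n inordK// (leq_trans (ltn_ord l))// !ltnS ltnW.
Qed.

Lemma simplex_path_back n (t : 'rV[unitI R]_n.+1) (i : 'I_n.+1) (x : R) :
  t ord0 i = I1 R -> 0 <= x ->
  affine (fun j : 'I_(n - i).+2 => inord (i.+1 + j) : 'I_n.+3)
    (simplex_path (\row_(l < n - i) t ord0 (inord (i.+1 + l))) x) =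
  simplex_path t (delay (times t) i.+1 + x).
Proof.
move=> ti x0; apply: val_inj; apply: tail_inj => j; rewrite tail_order_row.
have ni : (i <= n)%N by rewrite -ltnS.
(* Truncated subtraction sends every [j] up to [i.+1] to index 0, the constant 1. This is right
   because, [t ord0 i] being 1, these coordinates are already 1 at the cut. *)
rewrite (@tail_affine _ _ _ _ _ (j - i.+1)%N); last first.
  move=> l; rewrite leq_subLR inordK//.
  by have := ltn_ord l; lia.
rewrite tail_order_row.
have TE : times (\row_(l < n - i) t ord0 (inord (i.+1 + l))) =
    fun l => times t (i.+1 + l)%N by apply/funext => l; exact: times_back.
rewrite TE; have [ji|ij] := leqP j i.+1.
  rewrite (_ : j - i.+1 = 0)%N; last by apply/eqP; rewrite subn_eq0.
  case: j ji => //= j; rewrite ltnS => ji.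
  rewrite (leq_trans ji) ?(ltnW (ltn_ord i))//.
  have jiT := @delay_le _ (times t) j i (times_ge0 t) ji.
  by rewrite clamp_eq1// delayS times_ord ti /=; lra.
case: j ij => //= j ij; rewrite subSn//=.
rewrite (_ : (j - i.+1 <= n - i)%N = (j <= n.+1)%N); last first.
  by rewrite leq_subLR addSn subnKC.
case: ifP => // _; congr clamp.
by rewrite -{2}(subnKC (ij : (i.+1 <= j)%N)) delayD opprD addrACA subrr add0r.
Qed.

End SimplexPath.

(** * The maps [theta] and their face and composition equations *)

Section Representation.
Variables (R : realType) (E B : topologicalType) (p : E -> B).
Variable L : E -> (R -> B) -> R -> E.
Hypothesis pL : path_lifting p L.

Definition sing_path k (s : sing R B k.+1) (t : 'rV[unitI R]_k) (x : R) : B :=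
  s (simplex_path t x).

Lemma sing_path_continuous2 k (s : sing R B k.+1) :
  continuous (fun tx : 'rV[unitI R]_k * R => sing_path s tx.1 tx.2).
Proof.
by apply: (continuous_compose (@simplex_path_continuous R k)); exact: cts_fun.
Qed.

Lemma sing_path_continuous k (s : sing R B k.+1) (t : 'rV[unitI R]_k) :
  continuous (sing_path s t).
Proof.
apply: (continuous_compose (f := fun x : R => (t, x)) _
  (sing_path_continuous2 (s := s))).
by apply: continuous_pair; [exact: continuous_cst|move=> x].
Qed.

Lemma sing_path0 k (s : sing R B k.+1) t : sing_path s t 0 = vtx s ord0.
Proof. by rewrite /sing_path simplex_path0. Qed.

Lemma sing_path_end k (s : sing R B k.+1) t :
  sing_path s t (delay (times t) k.+1) = vtx s ord_max.
Proof. by rewrite /sing_path simplex_path_end. Qed.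

(** Defined on all of [E], so that the face and composition equations can be proved without any
    transport between fibres. *)
Definition holonomy k (s : sing R B k.+1) (t : 'rV[unitI R]_k) (e : E) : E :=
  lifts L (sing_path s t) (times t) e k.+1.

Lemma holonomy_fibre k (s : sing R B k.+1)
    (z : 'rV[unitI R]_k * fibre p (vtx s ord0)) :
  holonomy s z.1 (val z.2) \in fibre p (vtx s ord_max).
Proof.
apply/mem_set; rewrite /fibre /= /holonomy (lifts_over pL) ?sing_path_end//.
- exact: sing_path_continuous.
- exact: times_ge0.
- exact: times_le1.
- by rewrite fibreP sing_path0.
Qed.

Definition theta_fun k (s : sing R B k.+1)
    (z : 'rV[unitI R]_k * fibre p (vtx s ord0)) : fibre p (vtx s ord_max) :=
  exist _ (holonomy s z.1 (val z.2)) (holonomy_fibre z).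

Lemma theta_fun_continuous k (s : sing R B k.+1) : continuous (@theta_fun k s).
Proof.
apply: continuous_comp_initial.
apply: (lifts_continuous pL (Z := ('rV[unitI R]_k * fibre p (vtx s ord0))%type)
  (f := fun z => val z.2) (c := fun z => sing_path s z.1)
  (T := fun z => times z.1)).
- exact: (continuous_compose (@continuous_snd _ _) (@set_val_continuous _ _)).
- apply: (continuous_compose
    (f := fun zx : ('rV[unitI R]_k * fibre p (vtx s ord0)) * R =>
          (zx.1.1, zx.2)) _ (sing_path_continuous2 (s := s))).
  apply: continuous_pair; last exact: continuous_snd.
  exact: (continuous_compose (@continuous_fst _ _) (@continuous_fst _ _)).
- move=> j.
  exact: (continuous_compose (@continuous_fst _ _) (times_continuous (j := j))).
- by move=> z; exact: times_ge0.
- by move=> z; exact: times_le1.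
- by move=> z; rewrite fibreP sing_path0.
Qed.

Lemma theta_fun_equivalence k (s : sing R B k.+1) (t : 'rV[unitI R]_k) :
  homotopy_equivalence R (fun e : fibre p (vtx s ord0) => theta_fun (t, e)).
Proof.
pose D := delay (times t) k.+1.
(* The lengths are scaled but the path is not, so at [w] the lift ends over the point of the path at
   time [w * D]. *)
pose G (z : fibre p (vtx s ord0) * unitI R) :=
  lifts L (sing_path s t) (fun j => val z.2 * times t j) (val z.1) k.+1.
have cs := @sing_path_continuous k s t.
apply: (lifted_homotopy_equivalence pL (c := fun w => sing_path s t (w * D))
  (G := G)).
- apply: (continuous_compose _ cs (f := fun w : R => w * D)).
  by apply: continuous_mul; [move=> x|exact: continuous_cst].
- by rewrite mul0r sing_path0.
- by rewrite mul1r sing_path_end.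
- apply: (lifts_continuous pL (f := fun z : fibre p (vtx s ord0) * unitI R =>
    val z.1) (c := fun=> sing_path s t)).
  + exact: (continuous_compose (@continuous_fst _ _) (@set_val_continuous _ _)).
  + exact: (continuous_compose (@continuous_snd _ _) cs).
  + move=> j; apply: continuous_mul; last exact: continuous_cst.
    exact: (continuous_compose (@continuous_snd _ _) (@set_val_continuous _ _)).
  + by move=> z j; rewrite mulr_ge0 ?unitI_ge0 ?times_ge0.
  + by move=> z j; rewrite mulr_ile1 ?unitI_ge0 ?times_ge0 ?unitI_le1 ?times_le1.
  + by move=> z; rewrite fibreP sing_path0.
- move=> z; rewrite /G (lifts_over pL).
  + by rewrite /delay -mulr_sumr.
  + exact: cs.
  + by move=> j; rewrite mulr_ge0 ?unitI_ge0 ?times_ge0.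
  + by move=> j; rewrite mulr_ile1 ?unitI_ge0 ?times_ge0 ?unitI_le1 ?times_le1.
  + by rewrite fibreP sing_path0.
- by move=> e; rewrite /G (lifts_null pL)// => j; rewrite mul0r.
- move=> e; rewrite -[LHS]/(holonomy s t (val e)); congr (lifts _ _ _ _ _).
  by apply/funext => j; rewrite mul1r.
Qed.

Lemma holonomy_face n (s : sing R B n.+2) (i : 'I_n.+1)
    (t : 'rV[unitI R]_n.+1) (e : E) :
  t ord0 i = I0 R -> holonomy s t e = holonomy (inner_face s i) (col' i t) e.
Proof.
move=> ti; have Ti : times t i = 0 by rewrite times_ord ti.
rewrite /holonomy (lifts_bump pL _ _ Ti).
- rewrite (_ : times (col' i t) = fun j => times t (bump i j)).
    congr (lifts _ _ _ _ _); apply/funext => x.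
    by rewrite /sing_path -(simplex_path_face _ ti).
  by apply/funext => j; exact: times_col'.
- exact: ltnW.
Qed.

Lemma holonomy_comp n (s : sing R B n.+2) (i : 'I_n.+1)
    (t : 'rV[unitI R]_n.+1) (e : E) :
  t ord0 i = I1 R ->
  holonomy s t e =
  holonomy (back s i) (\row_(j < n - i) t ord0 (inord (i.+1 + j)))
    (holonomy (front s i) (\row_(j < i) t ord0 (inord j)) e).
Proof.
move=> ti; have T0 := times_ge0 t.
(* Of the $n+2$ pieces, the first $i+1$ belong to the front, whose default last length 1 is exactly
   [t ord0 i], and the other $n-i+1$ to the back. *)
have -> : holonomy s t e =
    lifts L (sing_path s t) (times t) e (i.+1 + (n - i).+1).
  by rewrite addnS addSn subnKC // -ltnS.
rewrite (liftsD pL) {1}/holonomy.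
have <- : lifts L (sing_path s t) (times t) e i.+1 =
    holonomy (front s i) (\row_(j < i) t ord0 (inord j)) e.
  apply: (lifts_eq pL) => [j ji|j x ji x0 x1]; first by rewrite times_front.
  rewrite /sing_path -(simplex_path_front ti)//.
  (* The unit window of a piece $j\le i$ ends by [delay (times t) i + 1], which is the cut because
     [t ord0 i] is 1; hence [simplex_path_front] applies. *)
  have /le_trans : delay (times t) j + x <= delay (times t) j + 1 by lra.
  apply; have := delay_le T0 (_ : (j <= i)%N); move=> /(_ ji).
  by rewrite delayS times_ord ti /=; lra.
apply: (lifts_eq pL) => [j _|j x _ x0 x1]; first by rewrite times_back.
rewrite /sing_path -simplex_path_back// addr_ge0//.
exact: sumr_ge0.
Qed.

End Representation.

Theorem theorem3p3 (R : realType) (E B : topologicalType) (p : E -> B)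
    (hp : fibration R p) :
  exists (theta0 : forall s : sing R B 0,
            continuousType (fibre p (vtx s ord0)) (fibre p (vtx s ord0)))
         (theta : forall (k : nat) (s : sing R B k.+1),
            continuousType ('rV[unitI R]_k * fibre p (vtx s ord0))%type
                           (fibre p (vtx s ord_max))),
    representation_up_to_homotopy theta0 theta.
Proof.
have [L pL] := fibration_path_lifting hp.
exists (fun s => idfun), (fun k s => mkcts (@theta_fun_continuous _ _ _ _ _ pL k s)).
split=> //.
- exact: theta_fun_equivalence.
(* Taking [val] removes [fibre_cast] by computation, which leaves the equations for [holonomy]. *)
- by move=> n s i t e ti; exact: (holonomy_face pL).
- by move=> n s i t e ti; exact: (holonomy_comp pL).
Qed.
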